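(* The simple modules of $A_0=U(\mathfrak{gl}(P))(1-e)$ form a two-dimensional family parametrized by scalars $a,b\in k$, denoted $L(0,a,b)$, as follows. (i) If $a=0$, $L(0,0,b)$ is one-dimensional, with $\mathfrak{gl}(P)$-action $y\mapsto(b)$, $x,y'\mapsto(0)$. (ii) If $a\neq0$, $L(0,a,b)$ is two-dimensional with underlying object $\mathbf 1^2$, with $\mathfrak{gl}(P)$-action $$y\mapsto\begin{pmatrix}b&0\\0&b+1\end{pmatrix},\quad x\mapsto\begin{pmatrix}0&1\\ a&0\end{pmatrix},\quad y'\mapsto0.$$ In both cases $e$ acts by $0$. Moreover, if $a=1$, then $L(0,1,b)=L(0,1,b+1)$ (isomorphic modules).
   Context: Let $k$ be an algebraically closed field of characteristic $2$. $\mathrm{Ver}_4^+$ is the symmetric tensor category whose objects are finite-dimensional $k$-vector spaces with an endomorphism $d$, $d^2=0$ (write $v'=dv$), with $d$ acting on tensor products by $d\otimes1+1\otimes d$ and braiding $c(v\otimes w)=w\otimes v+w'\otimes v'$; $\mathbf 1$ is the one-dimensional object with $d=0$; $P=k[d]/d^2$ is the two-dimensional object with basis $1,d$, and dual basis $1^*,d^*$ of $P^*$. $\mathfrak{gl}(P)=P\otimes P^*$ has bracket $[A,B]=AB-BA-B'A'$ and basis $x=1\otimes d^*$, $x'=e=1\otimes1^*+d\otimes d^*$, $y=1\otimes1^*$, $y'=d\otimes1^*$, where $dx=e$, $dy=y'$, $de=dy'=0$. Its universal enveloping algebra $U(\mathfrak{gl}(P))$ (the quotient of the tensor algebra by $a\otimes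 b-b\otimes a-b'\otimes a'=[a,b]$) is the algebra generated by $x,y,e,y'$ with $e$ central, $e^2=e$, $(y')^2=0$, $xy'+y'x=e$, $yy'+y'y=y'$, $xy+yx=x+y'+y'e$. So $e$ is a central idempotent; put $A_1=U(\mathfrak{gl}(P))e$ and $A_0=U(\mathfrak{gl}(P))(1-e)$. Modules are considered in $\mathrm{Ver}_4^+$: objects $M$ with an action morphism $U(\mathfrak{gl}(P))\otimes M\to M$ in $\mathrm{Ver}_4^+$. *)

(* Defs.v *)
From HB Require Import structures.
From mathcomp Require Import all_boot all_algebra generic_quotient boolp.

Set Implicit Arguments.
Unset Strict Implicit.
Unset Printing Implicit Defensive.

Import GRing.Theory.
Local Open Scope ring_scope.
Local Open Scope quotient_scope.

(* The algebra gl(P) = P (x) P^* as 2 x 2 matrices acting on columns, in the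
   basis (1, d) of P; d on P is the matrix [Pd], and d (x) 1 + 1 (x) d on
   P (x) P^* is A |-> Pd A + A Pd. *)
Section GlP.
Variable k : fieldType.

Definition Pd : 'M[k]_2 := delta_mx 1 0.

Definition gl_d (A : 'M[k]_2) : 'M[k]_2 := Pd *m A + A *m Pd.

Definition gl_br (A B : 'M[k]_2) : 'M[k]_2 :=
  A *m B - B *m A - gl_d B *m gl_d A.

Definition gl_x : 'M[k]_2 := delta_mx 0 1.
Definition gl_e : 'M[k]_2 := 1%:M.
Definition gl_y : 'M[k]_2 := delta_mx 0 0.
Definition gl_y' : 'M[k]_2 := delta_mx 1 0.

End GlP.

(* U(gl(P)): noncommutative polynomial expressions in the elements of gl(P),
   modulo the least congruence containing the axioms of k-algebras, linearity
   of the generators (these give the tensor algebra of gl(P)), and the relation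
   a b - b a - b' a' = [a, b]. *)
Section Enveloping.
Variable k : fieldType.

Inductive uterm : Type :=
  | UConst of k
  | UGen of 'M[k]_2
  | UAdd of uterm & uterm
  | UMul of uterm & uterm.

Inductive ucong : uterm -> uterm -> Prop :=
  | ucong_refl s : ucong s s
  | ucong_sym s t : ucong s t -> ucong t s
  | ucong_trans s t u : ucong s t -> ucong t u -> ucong s u
  | ucong_add s s' t t' :
      ucong s s' -> ucong t t' -> ucong (UAdd s t) (UAdd s' t')
  | ucong_mul s s' t t' :
      ucong s s' -> ucong t t' -> ucong (UMul s t) (UMul s' t')
  | ucong_addA s t u : ucong (UAdd s (UAdd t u)) (UAdd (UAdd s t) u)
  | ucong_addC s t : ucong (UAdd s t) (UAdd t s)
  | ucong_add0 s : ucong (UAdd (UConst 0) s) s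
  | ucong_addN s : ucong (UAdd (UMul (UConst (-1)) s) s) (UConst 0)
  | ucong_mulA s t u : ucong (UMul s (UMul t u)) (UMul (UMul s t) u)
  | ucong_mul1l s : ucong (UMul (UConst 1) s) s
  | ucong_mul1r s : ucong (UMul s (UConst 1)) s
  | ucong_mulDl s t u :
      ucong (UMul (UAdd s t) u) (UAdd (UMul s u) (UMul t u))
  | ucong_mulDr s t u :
      ucong (UMul s (UAdd t u)) (UAdd (UMul s t) (UMul s u))
  | ucong_constD a b : ucong (UConst (a + b)) (UAdd (UConst a) (UConst b))
  | ucong_constM a b : ucong (UConst (a * b)) (UMul (UConst a) (UConst b))
  | ucong_constC a s : ucong (UMul (UConst a) s) (UMul s (UConst a))
  | ucong_genD A B : ucong (UGen (A + B)) (UAdd (UGen A) (UGen B))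
  | ucong_genZ a A : ucong (UGen (a *: A)) (UMul (UConst a) (UGen A))
  | ucong_lie A B :
      ucong (UMul (UGen A) (UGen B))
            (UAdd (UAdd (UMul (UGen B) (UGen A))
                        (UMul (UGen (gl_d B)) (UGen (gl_d A))))
                  (UGen (gl_br A B))).

HB.instance Definition _ := gen_eqMixin uterm.
HB.instance Definition _ := gen_choiceMixin uterm.

Definition ucongb (s t : uterm) : bool := `[< ucong s t >].

Fact ucongb_refl : reflexive ucongb.
Proof. by move=> s; apply/asboolP; apply: ucong_refl. Qed.

Fact ucongb_sym : symmetric ucongb.
Proof. by move=> s t; apply/asboolP/asboolP; apply: ucong_sym. Qed.

Fact ucongb_trans : transitive ucongb.
Proof.
move=> t s u /asboolP st /asboolP tu; apply/asboolP.
exact: ucong_trans st tu.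
Qed.

Canonical ucongb_equiv := EquivRel ucongb ucongb_refl ucongb_sym ucongb_trans.

Definition UglP : Type := {eq_quot ucongb}.
HB.instance Definition _ := EqQuotient.on UglP.
HB.instance Definition _ := Choice.on UglP.

Lemma UglP_eq (s t : uterm) : ucong s t <-> \pi_UglP s = \pi_UglP t.
Proof.
split=> [st|]; first by apply/eqmodP/asboolP.
by move/eqmodP/asboolP.
Qed.

Lemma ucong_repr (s : uterm) : ucong (repr (\pi_UglP s)) s.
Proof. by apply/UglP_eq; rewrite reprK. Qed.

Definition Uadd (u v : UglP) : UglP := \pi_UglP (UAdd (repr u) (repr v)).
Definition Umul (u v : UglP) : UglP := \pi_UglP (UMul (repr u) (repr v)).
Definition Uconst (a : k) : UglP := \pi_UglP (UConst a).

Lemma UaddE s t : Uadd (\pi_UglP s) (\pi_UglP t) = \pi_UglP (UAdd s t).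
Proof. by apply/UglP_eq; apply: ucong_add; apply: ucong_repr. Qed.

Lemma UmulE s t : Umul (\pi_UglP s) (\pi_UglP t) = \pi_UglP (UMul s t).
Proof. by apply/UglP_eq; apply: ucong_mul; apply: ucong_repr. Qed.

Lemma UglP_ind (P : UglP -> Prop) :
  (forall s, P (\pi_UglP s)) -> forall u, P u.
Proof. by move=> Ps u; rewrite -[u]reprK. Qed.

Fact UaddA : associative Uadd.
Proof.
do 3![elim/UglP_ind=> ?]; rewrite !UaddE; exact/UglP_eq/ucong_addA.
Qed.
Fact UaddC : commutative Uadd.
Proof. do 2![elim/UglP_ind=> ?]; rewrite !UaddE; exact/UglP_eq/ucong_addC. Qed.
Fact Uadd0 : left_id (Uconst 0) Uadd.
Proof. elim/UglP_ind=> ?; rewrite !UaddE; exact/UglP_eq/ucong_add0. Qed.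
Fact UaddN : left_inverse (Uconst 0) (Umul (Uconst (-1))) Uadd.
Proof.
elim/UglP_ind=> ?; rewrite /Uconst !(UaddE, UmulE); exact/UglP_eq/ucong_addN.
Qed.

HB.instance Definition _ :=
  GRing.isZmodule.Build UglP UaddA UaddC Uadd0 UaddN.

Fact UmulA : associative Umul.
Proof.
do 3![elim/UglP_ind=> ?]; rewrite !UmulE; exact/UglP_eq/ucong_mulA.
Qed.
Fact Umul1l : left_id (Uconst 1) Umul.
Proof. elim/UglP_ind=> ?; rewrite !UmulE; exact/UglP_eq/ucong_mul1l. Qed.
Fact Umul1r : right_id (Uconst 1) Umul.
Proof. elim/UglP_ind=> ?; rewrite !UmulE; exact/UglP_eq/ucong_mul1r. Qed.
Fact UmulDl : left_distributive Umul Uadd.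
Proof.
do 3![elim/UglP_ind=> ?]; rewrite !(UaddE, UmulE); exact/UglP_eq/ucong_mulDl.
Qed.
Fact UmulDr : right_distributive Umul Uadd.
Proof.
do 3![elim/UglP_ind=> ?]; rewrite !(UaddE, UmulE); exact/UglP_eq/ucong_mulDr.
Qed.

(* The augmentation U(gl(P)) -> k, used for 1 != 0. *)
Fixpoint uterm_aug (s : uterm) : k :=
  match s with
  | UConst a => a
  | UGen _ => 0
  | UAdd s t => uterm_aug s + uterm_aug t
  | UMul s t => uterm_aug s * uterm_aug t
  end.

Lemma uterm_augP s t : ucong s t -> uterm_aug s = uterm_aug t.
Proof.
elim=> //=; intros; try congruence.
- exact: addrA.
- exact: addrC.
- exact: add0r.
- by rewrite mulN1r addNr.
- exact: mulrA.
- exact: mul1r.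
- exact: mulr1.
- exact: mulrDl.
- exact: mulrDr.
- exact: mulrC.
- by rewrite addr0.
- by rewrite mulr0.
- by rewrite !mulr0 !addr0.
Qed.

Definition Uaug (u : UglP) : k := uterm_aug (repr u).

Lemma UaugE s : Uaug (\pi_UglP s) = uterm_aug s.
Proof. exact/uterm_augP/ucong_repr. Qed.

Fact Uone_neq0 : Uconst 1 != 0 :> UglP.
Proof.
apply/eqP=> /(congr1 Uaug); rewrite !UaugE /= => /eqP.
by rewrite oner_eq0.
Qed.

HB.instance Definition _ := GRing.Zmodule_isNzRing.Build UglP
  UmulA Umul1l Umul1r UmulDl UmulDr Uone_neq0.

Lemma UpiD s t : \pi_UglP (UAdd s t) = \pi_UglP s + \pi_UglP t.
Proof. by rewrite -UaddE. Qed.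
Lemma UpiM s t : \pi_UglP (UMul s t) = \pi_UglP s * \pi_UglP t.
Proof. by rewrite -UmulE. Qed.

Lemma UconstD a b : Uconst (a + b) = Uconst a + Uconst b.
Proof. by rewrite -UpiD; apply/UglP_eq/ucong_constD. Qed.
Lemma UconstM a b : Uconst (a * b) = Uconst a * Uconst b.
Proof. by rewrite -UpiM; apply/UglP_eq/ucong_constM. Qed.
Lemma UconstC a u : Uconst a * u = u * Uconst a.
Proof. elim/UglP_ind: u => s; rewrite -!UpiM; exact/UglP_eq/ucong_constC. Qed.

Definition Uscale (a : k) (u : UglP) : UglP := Uconst a * u.

Fact UscaleA a b u : Uscale a (Uscale b u) = Uscale (a * b) u.
Proof. by rewrite /Uscale UconstM mulrA. Qed.
Fact Uscale1 : left_id 1 Uscale.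
Proof. by move=> u; rewrite /Uscale -[RHS]mul1r. Qed.
Fact UscaleDr : right_distributive Uscale +%R.
Proof. by move=> a u v; rewrite /Uscale mulrDr. Qed.
Fact UscaleDl u : {morph Uscale^~ u : a b / a + b}.
Proof. by move=> a b; rewrite /Uscale UconstD mulrDl. Qed.

HB.instance Definition _ := GRing.Zmodule_isLmodule.Build k UglP
  UscaleA Uscale1 UscaleDr UscaleDl.

Fact UscaleAl (a : k) (u v : UglP) : a *: (u * v) = (a *: u) * v.
Proof. exact: mulrA. Qed.
HB.instance Definition _ := GRing.Lmodule_isLalgebra.Build k UglP UscaleAl.

Fact UscaleAr (a : k) (u v : UglP) : a *: (u * v) = u * (a *: v).
Proof. by rewrite /GRing.scale /= /Uscale [RHS]mulrA -UconstC mulrA. Qed.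
HB.instance Definition _ := GRing.Lalgebra_isAlgebra.Build k UglP UscaleAr.

Definition Uin (A : 'M[k]_2) : UglP := \pi_UglP (UGen A).

Lemma UinD A B : Uin (A + B) = Uin A + Uin B.
Proof. by rewrite -UpiD; apply/UglP_eq/ucong_genD. Qed.

Lemma UinZ a A : Uin (a *: A) = a *: Uin A.
Proof. by rewrite /GRing.scale/= /Uscale -UpiM; apply/UglP_eq/ucong_genZ. Qed.

Lemma Uin0 : Uin 0 = 0.
Proof. by apply: (addIr (Uin 0)); rewrite -UinD !add0r. Qed.

Lemma UinM A B :
  Uin A * Uin B = Uin B * Uin A + Uin (gl_d B) * Uin (gl_d A) + Uin (gl_br A B).
Proof.
by have /UglP_eq := ucong_lie A B; rewrite !UpiD !UpiM.
Qed.

Lemma Uin_lie A B :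
  Uin A * Uin B - Uin B * Uin A - Uin (gl_d B) * Uin (gl_d A)
    = Uin (gl_br A B).
Proof. by rewrite UinM -addrA -opprD addrC addKr. Qed.

(* The endomorphism d of U(gl(P)), i.e. the derivation extending [gl_d]. *)
Fixpoint uterm_d (s : uterm) : uterm :=
  match s with
  | UConst _ => UConst 0
  | UGen A => UGen (gl_d A)
  | UAdd s t => UAdd (uterm_d s) (uterm_d t)
  | UMul s t => UAdd (UMul (uterm_d s) t) (UMul s (uterm_d t))
  end.

Definition Ud (u : UglP) : UglP := \pi_UglP (uterm_d (repr u)).

Hypothesis k2 : 2%N \in [pchar k].

Lemma addkk2 (V : lmodType k) (v : V) : v + v = 0.
Proof. by rewrite -mulr2n -scaler_nat (pcharf0 k2) scale0r. Qed.

Lemma gl_dD : {morph @gl_d k : A B / A + B}.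
Proof. by move=> A B; rewrite /gl_d mulmxDr mulmxDl addrACA. Qed.

Lemma gl_dZ a (A : 'M[k]_2) : gl_d (a *: A) = a *: gl_d A.
Proof. by rewrite /gl_d -scalemxAr -scalemxAl scalerDr. Qed.

Lemma gl_d_mul (A B : 'M[k]_2) : gl_d (A *m B) = gl_d A *m B + A *m gl_d B.
Proof.
rewrite /gl_d mulmxDl mulmxDr !mulmxA -addrA (addrA (A *m Pd k *m B)).
by rewrite addkk2 add0r.
Qed.

Lemma gl_dd (A : 'M[k]_2) : gl_d (gl_d A) = 0.
Proof.
have D2 : Pd k *m Pd k = 0 by rewrite /Pd mul_delta_mx_0.
rewrite /gl_d mulmxDr mulmxDl !mulmxA D2 mul0mx add0r.
by rewrite -(mulmxA A) D2 mulmx0 addr0 addkk2.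
Qed.

Lemma gl_d_br (A B : 'M[k]_2) :
  gl_d (gl_br A B) = gl_br (gl_d A) B + gl_br A (gl_d B).
Proof.
have dN (C : 'M[k]_2) : gl_d (- C) = - gl_d C.
  by rewrite -scaleN1r gl_dZ scaleN1r.
rewrite /gl_br !gl_dd gl_dD gl_dD !dN !gl_d_mul !gl_dd !(mulmx0, mul0mx).
rewrite !(addr0, subr0, oppr0) opprD.
by rewrite [RHS]addrACA; congr (_ + _); rewrite addrC.
Qed.

Lemma uterm_dP s t : ucong s t ->
  \pi_UglP (uterm_d s) = \pi_UglP (uterm_d t).
Proof.
have pi0 : \pi_UglP (UConst 0) = 0 by [].
have piG A : \pi_UglP (UGen A) = Uin A by [].
have piC a : \pi_UglP (UConst a) = Uconst a by [].
elim=> {s t} /=.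
- by [].
- by move=> s t _ ->.
- by move=> s t u _ -> _ ->.
- by move=> s s' t t' _; rewrite !UpiD => -> _ ->.
- move=> s s' t t' /UglP_eq ss' ds /UglP_eq tt' dt.
  by rewrite !(UpiD, UpiM) ss' tt' ds dt.
- by move=> s t u; rewrite !UpiD addrA.
- by move=> s t; rewrite !UpiD addrC.
- by move=> s; rewrite !UpiD add0r.
- move=> s; rewrite !(UpiD, UpiM) pi0 mul0r add0r.
  by have /UglP_eq := ucong_addN (uterm_d s); rewrite UpiD UpiM.
- move=> s t u; rewrite !(UpiD, UpiM).
  by rewrite mulrDl mulrDr !mulrA addrA.
- move=> s; rewrite !(UpiD, UpiM) pi0 mul0r add0r.
  by rewrite -UpiM; apply/UglP_eq/ucong_mul1l.
- move=> s; rewrite !(UpiD, UpiM) pi0 mulr0 addr0.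
  by rewrite -UpiM; apply/UglP_eq/ucong_mul1r.
- by move=> s t u; rewrite !(UpiD, UpiM) !(mulrDl, mulrDr) addrACA.
- by move=> s t u; rewrite !(UpiD, UpiM) !(mulrDl, mulrDr) addrACA.
- by move=> _ _; rewrite UpiD pi0 addr0.
- by move=> a b; rewrite !(UpiD, UpiM) pi0 mul0r mulr0 addr0.
- move=> a s; rewrite !(UpiD, UpiM) pi0 mul0r mulr0 addr0 add0r.
  exact: UconstC.
- by move=> A B; rewrite UpiD !piG gl_dD UinD.
- move=> a A; rewrite !(UpiD, UpiM) !piG pi0 mul0r add0r gl_dZ UinZ.
  by [].
- move=> A B; rewrite !(UpiD, UpiM) !piG gl_d_br UinD.
  rewrite (UinM (gl_d A) B) (UinM A (gl_d B)) !gl_dd Uin0 mul0r mulr0 !addr0.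
  by rewrite addrACA (addrC (Uin B * _)).
Qed.

Lemma UdE s : Ud (\pi_UglP s) = \pi_UglP (uterm_d s).
Proof. exact/uterm_dP/ucong_repr. Qed.

Lemma Ud_in A : Ud (Uin A) = Uin (gl_d A).
Proof. exact: UdE. Qed.

Lemma UdD : {morph @Ud : u v / u + v}.
Proof.
by do 2![elim/UglP_ind=> ?]; rewrite -UpiD !UdE /= UpiD.
Qed.

Lemma UdM u v : Ud (u * v) = Ud u * v + u * Ud v.
Proof.
by elim/UglP_ind: u; elim/UglP_ind: v=> ? ?; rewrite -UpiM !UdE /= UpiD !UpiM.
Qed.

Lemma UdZ a u : Ud (a *: u) = a *: Ud u.
Proof.
have -> : a *: u = Uconst a * u by [].
by rewrite UdM /Uconst UdE /= -/(Uconst 0) mul0r add0r.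
Qed.

Definition Ue : UglP := Uin (gl_e k).

Lemma gl_de : gl_d (gl_e k) = 0.
Proof. by rewrite /gl_d mulmx1 mul1mx addkk2. Qed.

Lemma Ud_e : Ud Ue = 0.
Proof. by rewrite Ud_in gl_de Uin0. Qed.

Lemma gl_dx : gl_d (gl_x k) = gl_e k.
Proof.
rewrite /gl_d !mul_delta_mx; apply/matrixP=> i j; rewrite !mxE.
by case: i => [[|[|[]]]] //= ?; case: j => [[|[|[]]]] //= ?;
   rewrite ?addr0 ?add0r.
Qed.

Lemma Ue_central u : u * Ue = Ue * u.
Proof.
elim/UglP_ind: u; elim=> [a|A|s IHs t IHt|s IHs t IHt].
- exact: UconstC.
- rewrite -/(Uin A) UinM /gl_br gl_de Uin0 !mul0r mulmx1 mul1mx.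
  by rewrite mul0mx subrr subr0 Uin0 !addr0.
- by rewrite UpiD mulrDl mulrDr IHs IHt.
- by rewrite UpiM -mulrA IHt mulrA IHs mulrA.
Qed.

Lemma Ue_idem : Ue * Ue = Ue.
Proof.
have := UinM (gl_x k) (gl_x k); rewrite -addrA -[LHS]addr0 => /addrI.
rewrite /gl_br subrr sub0r !gl_dx mulmx1 -scaleN1r UinZ scaleN1r.
by move/esym/subr0_eq.
Qed.

End Enveloping.

Arguments Ud {k} u.
Arguments Ue {k}.

(* A_0 = U(gl(P)) (1 - e), an algebra with unit 1 - e. *)
Section A0.
Variable k : fieldType.

Definition inA0 : {pred UglP k} := fun u => u * (1 - Ue) == u.

Lemma inA0P u : reflect (u * Ue = 0) (u \in inA0).
Proof.
rewrite -topredE /= /inA0 mulrBr mulr1 -subr_eq0 addrAC subrr sub0r oppr_eq0.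
exact: eqP.
Qed.

Fact inA0_submod : submod_closed inA0.
Proof.
split=> [|a u v /inA0P u0 /inA0P v0]; apply/inA0P; first exact: mul0r.
by rewrite mulrDl v0 addr0 -scalerAl u0 scaler0.
Qed.
HB.instance Definition _ := GRing.isSubmodClosed.Build k (UglP k) inA0
  (GRing.submod_closed_semi inA0_submod).

End A0.

(* [k2] is a parameter because the ring structure needs e to be idempotent. *)
Record A0 (k : fieldType) (k2 : 2%N \in [pchar k]) : Type :=
  InA0 { A0val : UglP k; A0valP : A0val \in @inA0 k }.

Section A0Algebra.
Variables (k : fieldType) (k2 : 2%N \in [pchar k]).
Local Notation inA0 := (@inA0 k).
Local Notation A0 := (A0 k2).

HB.instance Definition _ := [isSub of A0 for @A0val k k2].
HB.instance Definition _ := [Choice of A0 by <:].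
HB.instance Definition _ := [SubChoice_isSubLmodule of A0 by <:].

Fact inA0_one : 1 - Ue \in inA0.
Proof. by apply/inA0P; rewrite mulrBl mul1r Ue_idem // subrr. Qed.

Fact inA0_mul (u : UglP k) (v : UglP k) : v \in inA0 -> u * v \in inA0.
Proof. by move=> /inA0P v0; apply/inA0P; rewrite -mulrA v0 mulr0. Qed.

Fact inA0_d (u : UglP k) : u \in inA0 -> Ud u \in inA0.
Proof.
move=> /inA0P u0; apply/inA0P.
have := congr1 Ud u0; rewrite UdM // Ud_e // mulr0 addr0 => ->.
by rewrite -(scale0r (0 : UglP k)) UdZ // !scale0r.
Qed.

Definition A0one : A0 := InA0 k2 inA0_one.
Definition A0mul (u v : A0) : A0 := InA0 k2 (inA0_mul (A0val u) (A0valP v)).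
Definition A0d (u : A0) : A0 := InA0 k2 (inA0_d (A0valP u)).

Fact A0mulA : associative A0mul.
Proof. by move=> u v w; apply: val_inj; rewrite /= mulrA. Qed.
Fact A0mulr1 : right_id A0one A0mul.
Proof. by move=> u; apply: val_inj; apply/eqP; exact: (A0valP u). Qed.
Fact A0mul1r : left_id A0one A0mul.
Proof.
move=> u; rewrite -[RHS]A0mulr1; apply: val_inj => /=.
by rewrite mulrBl mulrBr mul1r mulr1 Ue_central.
Qed.
Fact A0mulDl : left_distributive A0mul +%R.
Proof. by move=> u v w; apply: val_inj; rewrite /= mulrDl. Qed.
Fact A0mulDr : right_distributive A0mul +%R.
Proof. by move=> u v w; apply: val_inj; rewrite /= mulrDr. Qed.

Fact A0one_neq0 : A0one != 0.
Proof.
apply/eqP=> /(congr1 (fun u => Uaug (A0val u))) /=.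
have -> : 1 - Ue = \pi_(UglP k)
    (UAdd (UConst 1) (UMul (UConst (-1)) (UGen (gl_e k)))).
  by rewrite UpiD UpiM.
rewrite (UaugE (UConst 0)) UaugE /= mulr0 addr0 => /eqP.
by rewrite oner_eq0.
Qed.

HB.instance Definition _ := GRing.Zmodule_isNzRing.Build A0
  A0mulA A0mul1r A0mulr1 A0mulDl A0mulDr A0one_neq0.

Fact A0scaleAl (a : k) (u v : A0) : a *: (u * v) = (a *: u) * v.
Proof. by apply: val_inj; rewrite /= scalerAl. Qed.
HB.instance Definition _ := GRing.Lmodule_isLalgebra.Build k A0 A0scaleAl.
Fact A0scaleAr (a : k) (u v : A0) : a *: (u * v) = u * (a *: v).
Proof. by apply: val_inj; rewrite /= scalerAr. Qed.
HB.instance Definition _ := GRing.Lalgebra_isAlgebra.Build k A0 A0scaleAr.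

(* The image a (1 - e) of an element a of gl(P), through which gl(P) acts on A_0-modules. *)
Definition A0in (a : 'M[k]_2) : A0 := InA0 k2 (inA0_mul (Uin a) inA0_one).

End A0Algebra.

(* Objects of Ver_4^+. The braiding is not part of the data of a module; it
   enters through the relations of U(gl(P)). *)
Record ver4Obj (k : fieldType) : Type := Ver4Obj {
  ver4_sort :> vectType k;
  ver4_d : 'End(ver4_sort);
  ver4_dd : (ver4_d \o ver4_d)%VF = 0
}.

(* The object 1^n. *)
Definition ver4_unit (k : fieldType) (n : nat) : ver4Obj k :=
  @Ver4Obj k 'cV[k]_n 0 (comp_lfun0l _ _).

(* Modules over an algebra A of (the ind-completion of) Ver_4^+ with
   endomorphism dA: the last field says that A (x) M -> M commutes with d. *)
Record ver4Mod (k : fieldType) (A : algType k) (dA : A -> A) : Type := Ver4Mod {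
  vmod_obj :> ver4Obj k;
  vact : A -> 'End(vmod_obj);
  vact_linear : linear vact;
  vact1 : vact 1 = \1%VF;
  vactM : forall u v, vact (u * v) = (vact u \o vact v)%VF;
  vact_d : forall u m,
    ver4_d vmod_obj (vact u m) = vact (dA u) m + vact u (ver4_d vmod_obj m)
}.

Section Modules.
Variables (k : fieldType) (A : algType k) (dA : A -> A).
Implicit Types M N : ver4Mod dA.

Definition vsubmod M (W : {vspace M}) : Prop :=
  (ver4_d M @: W <= W)%VS /\ forall u, (vact M u @: W <= W)%VS.

Definition vsimple M : Prop :=
  fullv != 0%VS :> {vspace M}
  /\ forall W : {vspace M}, vsubmod W -> W = 0%VS \/ W = fullv.

Definition ver4_iso (X Y : ver4Obj k) (f : 'Hom(X, Y)) : Prop :=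
  bijective f /\ forall v, f (ver4_d X v) = ver4_d Y (f v).

Definition vmod_iso M N : Prop :=
  exists f : 'Hom(M, N),
    ver4_iso f /\ forall u m, f (vact M u m) = vact N u (f m).

End Modules.

Definition A0Mod (k : fieldType) (k2 : 2%N \in [pchar k]) : Type :=
  ver4Mod (@A0d k k2).

(* M is isomorphic to 1^n with the elements x, y, y', e of gl(P) acting by the
   matrices X, Y, Y', E. *)
Definition A0_matrix_form (k : fieldType) (k2 : 2%N \in [pchar k])
    (M : A0Mod k2) (n : nat) (X Y Y' E : 'M[k]_n) : Prop :=
  exists f : 'Hom(ver4_unit k n, M), ver4_iso f
    /\ forall v : 'cV[k]_n,
      [/\ vact M (A0in k2 (gl_x k)) (f v) = f (X *m v),
          vact M (A0in k2 (gl_y k)) (f v) = f (Y *m v),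
          vact M (A0in k2 (gl_y' k)) (f v) = f (Y' *m v)
        & vact M (A0in k2 (gl_e k)) (f v) = f (E *m v)].

Definition mx2 (k : fieldType) (a b c d : k) : 'M[k]_2 :=
  \matrix_(i, j) if i == 0 then (if j == 0 then a else b)
                            else (if j == 0 then c else d).

(* Main.v *)
From HB Require Import structures.
Require Import Defs.
From mathcomp Require Import all_boot all_algebra.
From mathcomp Require Import generic_quotient ring.

Import GRing.Theory.
Set Implicit Arguments.
Unset Strict Implicit.
Unset Printing Implicit Defensive.

Local Open Scope ring_scope.
Local Open Scope quotient_scope.

(** In A_0 the element e is 0, so the relations become
      xy + yx = x + y',  xy' = y'x,  yy' + y'y = y',  y'^2 = 0,
    and, on a module, d commutes with x and y' while dy + yd = y'.  Both y' and
    d square to zero, so their kernels are nonzero in a nonzero module.  The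
    kernel of y' is a submodule; hence y' = 0 on a simple module, and then the
    kernel of d is a submodule as well, so d = 0.

    What remains is a pair of operators with xy + yx = x.  Here x^2 commutes
    with x and y, so it acts by a scalar a, and y has an eigenvector v, say
    yv = bv.  If a = 0, the kernel of x is a nonzero submodule, so x = 0 and y
    is the scalar b; if a != 0, then xv is an eigenvector of y for b + 1.
    Either way, formulas in v and xv give a nonzero morphism from the candidate
    L(a,b) to the module, which is an isomorphism by Schur's lemma.  That is
    [simple_iso_L], the heart of the classification: a simple module is L(a,b)
    as soon as x^2 = a and b is an eigenvalue of y.  Applied to L(1,b), in which
    b + 1 is also an eigenvalue of y, it gives L(1,b) = L(1,b+1).  Conversely
    x^2 and the spectrum of y recover a, and b up to b |-> b + 1.

    The modules L(a,b) themselves come from [mx_module]: any two matrices with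
    XY + YX = X, together with y' = e = d = 0, satisfy all the relations. *)

(** * Eigenvectors over an algebraically closed field *)

Lemma lfun_eigenvector (k : closedFieldType) (V : vectType k) (g : 'End(V)) :
  fullv != 0%VS :> {vspace V} -> exists c v, v != 0 /\ g v = c *: v.
Proof.
move=> V0; have bV := vbasisP (fullv : {vspace V}).
set A := passmx.mxof (vbasis fullv) (vbasis fullv) g.
have /closed_rootP [c rc] : size (char_poly A) != 1%N.
  by rewrite size_char_poly eqSS dimv_eq0.
have cA : eigenvalue A c by rewrite eigenvalue_root_char.
have : passmx.leigenspace g c != 0%VS.
  by rewrite (passmx.leigenspaceE bV) passmx.vsof_eq0.
rewrite -vpick0 => v0; exists c, (vpick (passmx.leigenspace g c)).
split=> //; have := memv_pick (passmx.leigenspace g c).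
by rewrite memv_ker !lfun_simp subr_eq0 => /eqP.
Qed.

(** * Generators and relations of A_0 *)

Section A0Relations.
Variables (k : fieldType) (k2 : 2%N \in [pchar k]).
Local Notation A0 := (A0 k2).
Local Notation x := (A0in k2 (gl_x k)).
Local Notation y := (A0in k2 (gl_y k)).
Local Notation y' := (A0in k2 (gl_y' k)).

(** The projection U(gl(P)) -> A_0, a ring morphism because e is a central
    idempotent. *)
Definition A0proj (u : UglP k) : A0 := InA0 k2 (inA0_mul u (inA0_one k)).

Lemma A0projD u v : A0proj (u + v) = A0proj u + A0proj v.
Proof. by apply: val_inj; rewrite /= mulrDl. Qed.

Lemma A0projM u v : A0proj (u * v) = A0proj u * A0proj v.
Proof.
have uC w : w * (1 - Ue) = (1 - Ue) * w :> UglP k.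
  by rewrite mulrBr mulrBl mulr1 mul1r Ue_central.
have ee : (1 - Ue) * (1 - Ue) = 1 - Ue :> UglP k.
  exact/eqP/(inA0_one k).
by apply: val_inj; rewrite /= -!mulrA (mulrA (1 - Ue)) -uC -[in RHS]mulrA ee.
Qed.

Lemma A0projK (u : A0) : A0proj (A0val u) = u.
Proof. by apply: val_inj; apply/eqP; exact: (A0valP u). Qed.

Lemma A0inD A B : A0in k2 (A + B) = A0in k2 A + A0in k2 B.
Proof. by rewrite -A0projD -UinD. Qed.

Lemma A0inZ a A : A0in k2 (a *: A) = a *: A0in k2 A.
Proof. by apply: val_inj; rewrite /= UinZ scalerAl. Qed.

Lemma A0in_e : A0in k2 (gl_e k) = 0.
Proof. by apply: val_inj; rewrite /= mulrBr mulr1 -/Ue Ue_idem // subrr. Qed.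

Lemma A0in0 : A0in k2 0 = 0.
Proof. by apply: val_inj; rewrite /= Uin0 mul0r. Qed.

Let ord2_0 l : Ordinal (l : (0 < 2)%N) = 0.
Proof. exact: val_inj. Qed.

Let ord2_1 l : Ordinal (l : (1 < 2)%N) = 1.
Proof. exact: val_inj. Qed.

Lemma gl_basis (A : 'M[k]_2) :
  A = A 0 1 *: gl_x k + A 1 1 *: gl_e k + (A 0 0 - A 1 1) *: gl_y k
      + A 1 0 *: gl_y' k.
Proof.
apply/matrixP=> i j; rewrite !mxE.
by case: i => [[|[|[]]]] //= ?; case: j => [[|[|[]]]] //= ?;
  rewrite ?ord2_0 ?ord2_1 /=; ring.
Qed.

(** A_0 is generated as an algebra by the images of x, y and y', since e becomes
    0 in A_0.  This reduces stability of subspaces and commutation of maps to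
    these three elements. *)
Lemma A0_ind (P : A0 -> Prop) :
  P 1 -> P x -> P y -> P y' ->
  (forall c u v, P u -> P v -> P (c *: u + v)) ->
  (forall u v, P u -> P v -> P (u * v)) ->
  forall u, P u.
Proof.
move=> P1 Px Py Py' PD PM u.
have P0 : P 0 by rewrite -(addNr 1) -scaleN1r; apply: PD.
have PZ c w : P w -> P (c *: w) by move=> Pw; rewrite -[_ *: _]addr0; apply: PD.
rewrite -[u]A0projK; elim/UglP_ind: (A0val u); elim=> [c|A|s Ps t Pt|s Ps t Pt].
- have -> : A0proj (\pi_(UglP k) (UConst c)) = c *: 1; last exact: PZ.
  by apply: val_inj.
- change (P (A0in k2 A)); rewrite (gl_basis A) !A0inD !A0inZ A0in_e scaler0 addr0.
  by rewrite -addrA; apply: (PD) => //; apply: PD => //; apply: PZ.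
- by rewrite UpiD A0projD -[A0proj (\pi_(UglP k) s)]scale1r; apply: PD.
- by rewrite UpiM A0projM; apply: PM.
Qed.

Lemma A0inM A B : A0in k2 A * A0in k2 B
  = A0in k2 B * A0in k2 A + A0in k2 (gl_d B) * A0in k2 (gl_d A)
    + A0in k2 (gl_br A B).
Proof.
by rewrite -[LHS]A0projM UinM !A0projD !A0projM.
Qed.

Lemma A0d_in A : A0d (A0in k2 A) = A0in k2 (gl_d A).
Proof.
have d1 : Ud (1 : UglP k) = 0.
  have := UdM k2 (1 : UglP k) 1; rewrite !mulr1 mul1r => d11.
  by apply: (addrI (Ud 1)); rewrite addr0 -d11.
apply: val_inj; rewrite /= UdM // Ud_in // UdD // -scaleN1r UdZ // Ud_e //.
by rewrite d1 scaler0 addr0 mulr0 addr0 scaleN1r.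
Qed.

Lemma gl_dy : gl_d (gl_y k) = gl_y' k.
Proof. by rewrite /gl_d mul_delta_mx mul_delta_mx_0 // addr0. Qed.

Lemma gl_dy' : gl_d (gl_y' k) = 0.
Proof. by rewrite /gl_d !mul_delta_mx_0 // addr0. Qed.

Lemma A0_xy : x * y = y * x + x + y'.
Proof.
rewrite A0inM gl_dx // gl_dy A0in_e mulr0 addr0 /gl_br gl_dx // gl_dy mulmx1.
rewrite mul_delta_mx_0 // mul_delta_mx sub0r -/(gl_x k) -opprD.
by rewrite -scaleN1r A0inZ A0inD (oppr_pchar2 k2) scale1r addrA.
Qed.

Lemma A0_xy' : x * y' = y' * x.
Proof.
rewrite A0inM gl_dx // gl_dy' A0in0 mul0r addr0 /gl_br gl_dy' mul0mx subr0.
rewrite !mul_delta_mx.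
have -> : delta_mx 0 0 - delta_mx 1 1 = gl_e k.
  apply/matrixP=> i j; rewrite !mxE.
  case: i => [[|[|[]]]] //= ?; case: j => [[|[|[]]]] //= ?;
  by rewrite ?ord2_0 ?ord2_1 /= ?subr0 ?sub0r ?(oppr_pchar2 k2).
by rewrite A0in_e addr0.
Qed.

Lemma A0_yy' : y * y' = y' * y + y'.
Proof.
rewrite A0inM gl_dy' A0in0 mul0r addr0 /gl_br gl_dy' mul0mx subr0.
rewrite mul_delta_mx_0 // mul_delta_mx sub0r -/(gl_y' k).
by rewrite -scaleN1r A0inZ (oppr_pchar2 k2) scale1r.
Qed.

(** This is the relation of U(gl(P)) for the pair (y, y), whose bracket is
    yy - yy - y'y' = 0 as matrices; the terms y * y cancel. *)
Lemma A0_y'2 : y' * y' = 0.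
Proof.
have := A0inM (gl_y k) (gl_y k).
rewrite gl_dy /gl_br gl_dy subrr mul_delta_mx_0 // subr0 A0in0 addr0.
by rewrite -[LHS]addr0 => /addrI.
Qed.

End A0Relations.

(** * Simple modules are killed by y' and d *)

Section ModuleTheory.
Variables (k : fieldType) (k2 : 2%N \in [pchar k]).
Local Notation x := (A0in k2 (gl_x k)).
Local Notation y := (A0in k2 (gl_y k)).
Local Notation y' := (A0in k2 (gl_y' k)).
Implicit Types M N : A0Mod k2.

Lemma vactL M c u v m :
  vact M (c *: u + v) m = c *: vact M u m + vact M v m.
Proof. by rewrite vact_linear !lfun_simp. Qed.

Lemma vact_mul M u v m : vact M (u * v) m = vact M u (vact M v m).
Proof. by rewrite vactM lfunE. Qed.

Lemma vactD M u v m : vact M (u + v) m = vact M u m + vact M v m.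
Proof. by rewrite -[u in LHS]scale1r vactL scale1r. Qed.

Lemma vact0 M m : vact M 0 m = 0.
Proof. by apply: (addIr (vact M 0 m)); rewrite -vactD !add0r. Qed.

Lemma vsubmod_gen M (W : {vspace M}) :
  (forall w, w \in W -> ver4_d M w \in W) ->
  (forall w, w \in W -> vact M x w \in W) ->
  (forall w, w \in W -> vact M y w \in W) ->
  (forall w, w \in W -> vact M y' w \in W) ->
  vsubmod W.
Proof.
move=> Wd Wx Wy Wy'; split=> [|u]; apply/subvP=> _ /memv_imgP[w Ww ->].
  exact: Wd.
move: w Ww; elim/A0_ind: u => //.
- by move=> w; rewrite vact1 lfunE.
- by move=> c u v Wu Wv w Ww; rewrite vactL memvD ?memvZ ?Wu ?Wv.
- by move=> u v Wu Wv w Ww; rewrite vact_mul Wu ?Wv.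
Qed.

Lemma vact_comm_gen M N (f : 'Hom(M, N)) :
  (forall m, f (vact M x m) = vact N x (f m)) ->
  (forall m, f (vact M y m) = vact N y (f m)) ->
  (forall m, f (vact M y' m) = vact N y' (f m)) ->
  forall u m, f (vact M u m) = vact N u (f m).
Proof.
move=> fx fy fy'; elim/A0_ind => //.
- by move=> m; rewrite !vact1 !lfunE.
- by move=> c u v fu fv m; rewrite !vactL linearP /= fu fv.
- by move=> u v fu fv m; rewrite !vact_mul fu fv.
Qed.

(** The kernel and the image of a morphism are submodules, so between simple
    modules a morphism that is nonzero at one vector is bijective. *)
Lemma schur M N (f : 'Hom(M, N)) v :
  vsimple M -> vsimple N ->
  (forall m, f (ver4_d M m) = ver4_d N (f m)) ->
  (forall u m, f (vact M u m) = vact N u (f m)) ->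
  f v != 0 -> vmod_iso M N.
Proof.
move=> [_ sM] [_ sN] fd fu fv0.
have kf : lker f = 0%VS.
  case: (sM (lker f)) => [|//|kf].
    apply: vsubmod_gen => w; rewrite !memv_ker ?fd ?fu => /eqP->;
    by rewrite linear0.
  by move: fv0; rewrite -memv_ker kf memvf.
have If : limg f = fullv.
  case: (sN (limg f)) => [|If|//].
    by apply: vsubmod_gen => _ /memv_imgP[w _ ->]; rewrite -?fd -?fu memv_img ?memvf.
  by have := memv_img f (memvf v); rewrite If memv0 (negPf fv0).
exists f; split=> //; split=> //; exists (f^-1)%VF.
  by apply: lker0_lfunK; rewrite kf.
by move=> w; apply: limg_lfunVK; rewrite If memvf.
Qed.

(** The principle behind every reduction below: an operator whose kernel is a
    submodule, and which kills one nonzero vector, is zero on a simple module.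
    It speaks of operators rather than morphisms because y', d and x do not
    commute with y. *)
Lemma simple_kills M (g : 'End(M)) v :
  vsimple M -> v != 0 -> g v = 0 -> vsubmod (lker g) -> forall m, g m = 0.
Proof.
move=> [_ sM] v0 gv0 /sM[] kg m.
  by move: gv0 v0 => /eqP; rewrite -memv_ker kg memv0 => ->.
by apply/eqP; rewrite -memv_ker kg memvf.
Qed.

Lemma simple_nilpotent M (g : 'End(M)) :
  vsimple M -> (forall m, g (g m) = 0) -> vsubmod (lker g) ->
  forall m, g m = 0.
Proof.
move=> sM gg kg; have [] := sM; rewrite -vpick0; set v := vpick _ => v0 _.
have [gv0|gv0] := eqVneq (g v) 0; first exact: simple_kills v0 gv0 kg.
exact: (@simple_kills _ _ (g v)).
Qed.

Section Relations.
Variables (M : A0Mod k2) (m : M).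
Local Notation act := (vact M).

Lemma act_xy : act x (act y m) = act y (act x m) + act x m + act y' m.
Proof. by rewrite -!vact_mul A0_xy !vactD. Qed.

Lemma act_xy' : act x (act y' m) = act y' (act x m).
Proof. by rewrite -!vact_mul A0_xy'. Qed.

Lemma act_yy' : act y (act y' m) = act y' (act y m) + act y' m.
Proof. by rewrite -!vact_mul A0_yy' !vactD. Qed.

Lemma act_y'2 : act y' (act y' m) = 0.
Proof. by rewrite -!vact_mul A0_y'2 vact0. Qed.

Lemma d_x : ver4_d M (act x m) = act x (ver4_d M m).
Proof. by rewrite vact_d A0d_in gl_dx A0in_e vact0 add0r. Qed.

Lemma d_y : ver4_d M (act y m) = act y' m + act y (ver4_d M m).
Proof. by rewrite vact_d A0d_in gl_dy. Qed.

Lemma d_y' : ver4_d M (act y' m) = act y' (ver4_d M m).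
Proof. by rewrite vact_d A0d_in gl_dy' A0in0 vact0 add0r. Qed.

Lemma d_d : ver4_d M (ver4_d M m) = 0.
Proof. by have := congr1 (fun g : 'End(M) => g m) (ver4_dd M); rewrite !lfunE. Qed.

End Relations.

Section Simple.
Variables (M : A0Mod k2) (sM : vsimple M).
Local Notation act := (vact M).

(** If y'w = 0, then y'(yw) = y(y'w) + y'w = 0 as well, so ker y' is stable under
    y although y' and y do not commute. *)
Lemma simple_y'0 m : act y' m = 0.
Proof.
move: m; apply: simple_nilpotent => // [m|]; first exact: act_y'2.
apply: vsubmod_gen => w; rewrite !memv_ker => /eqP w0.
- by rewrite -d_y' w0 linear0.
- by rewrite -act_xy' w0 linear0.
- by have := act_yy' w; rewrite w0 linear0 addr0 => <-.
- by rewrite act_y'2.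
Qed.

(** Stability of ker d under y needs y' = 0, because dy + yd = y'. *)
Lemma simple_d0 m : ver4_d M m = 0.
Proof.
move: m; apply: simple_nilpotent => // [m|]; first exact: d_d.
apply: vsubmod_gen => w; rewrite !memv_ker => /eqP w0.
- by rewrite d_d.
- by rewrite d_x w0 linear0.
- by rewrite d_y w0 linear0 simple_y'0 addr0.
- by rewrite simple_y'0 linear0.
Qed.

Lemma simple_xy m : act x (act y m) = act y (act x m) + act x m.
Proof. by rewrite act_xy simple_y'0 addr0. Qed.

Lemma simple_vsubmod (W : {vspace M}) :
  (forall w, w \in W -> act x w \in W) ->
  (forall w, w \in W -> act y w \in W) -> vsubmod W.
Proof.
move=> Wx Wy; apply: vsubmod_gen => // w _.
  by rewrite simple_d0 mem0v.
by rewrite simple_y'0 mem0v.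
Qed.

(** x^2 y = x(yx + x) = (yx + x)x + x^2, and the two terms x^2 cancel in
    characteristic 2. *)
Lemma simple_x2y m : act x (act x (act y m)) = act y (act x (act x m)).
Proof. by rewrite simple_xy linearD /= simple_xy -addrA (addkk2 k2) addr0. Qed.

Lemma simple_x0 : (forall m, act x (act x m) = 0) -> forall m, act x m = 0.
Proof.
move=> x2; apply: simple_nilpotent => //; apply: simple_vsubmod => w;
  rewrite !memv_ker => /eqP w0; first by rewrite x2.
by rewrite simple_xy w0 linear0 addr0.
Qed.

Lemma simple_yb b v : (forall m, act x m = 0) ->
  v != 0 -> act y v = b *: v -> forall m, act y m = b *: m.
Proof.
move=> x0 v0 yv m.
have gE w : (act y - b *: \1%VF) w = act y w - b *: w by rewrite !lfun_simp.
apply/eqP; rewrite -subr_eq0 -gE; apply/eqP; move: m.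
apply: (simple_kills sM v0); first by rewrite gE yv subrr.
apply: simple_vsubmod => w; rewrite !memv_ker !gE subr_eq0 => /eqP w0.
  by rewrite x0 linear0 scaler0 subrr.
by rewrite w0 linearZ /= w0 subrr.
Qed.

End Simple.
End ModuleTheory.

(** * The scalars a and b *)

Section Closed.
Variables (k : closedFieldType) (k2 : 2%N \in [pchar k]).
Local Notation x := (A0in k2 (gl_x k)).
Local Notation y := (A0in k2 (gl_y k)).

(** The scalar a is an eigenvalue of x^2, which is central, so x^2 - a vanishes on
    the whole module; y is not central and only provides one eigenvector. *)
Lemma simple_eigen (M : A0Mod k2) : vsimple M ->
  exists a b v, [/\ v != 0, forall m, vact M x (vact M x m) = a *: m
    & vact M y v = b *: v].
Proof.
move=> sM; have [M0 _] := sM.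
have [b [v [v0 yv]]] := lfun_eigenvector (vact M y) M0.
have [a [w [w0 xw]]] := lfun_eigenvector (vact M (x * x)) M0.
exists a, b, v; split=> // m; apply/eqP; rewrite -subr_eq0; apply/eqP.
have gE u : (vact M (x * x) - a *: \1%VF) u = vact M x (vact M x u) - a *: u.
  by rewrite !lfun_simp /= vact_mul.
rewrite -gE; move: m; apply: (simple_kills sM w0).
  by rewrite gE -vact_mul xw subrr.
apply: (simple_vsubmod sM) => u; rewrite !memv_ker !gE subr_eq0 => /eqP u0.
  by rewrite u0 linearZ subrr.
by rewrite (simple_x2y sM) u0 linearZ subrr.
Qed.

End Closed.

(** * Modules given by two matrices *)

Section MatrixModule.
Variables (k : fieldType) (k2 : 2%N \in [pchar k]) (n : nat).
Variables (X Y : 'M[k]_n) (XY : X *m Y + Y *m X = X).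

(** The linear map gl(P) -> M_n with x |-> X, y |-> Y and e, y' |-> 0; the
    coefficients are those of [gl_basis]. *)
Definition gl_rep (A : 'M[k]_2) : 'M[k]_n :=
  A 0 1 *: X + (A 0 0 - A 1 1) *: Y.

Fixpoint uterm_rep (s : uterm k) : 'M[k]_n :=
  match s with
  | UConst c => c%:M
  | UGen A => gl_rep A
  | UAdd s t => uterm_rep s + uterm_rep t
  | UMul s t => uterm_rep s *m uterm_rep t
  end.

Let sum2 (F : 'I_2 -> k) : \sum_(i < 2) F i = F 0 + F 1.
Proof. by rewrite !big_ord_recl big_ord0 addr0; congr (_ + F _); apply: val_inj. Qed.

(** The image of d on gl(P) is spanned by e and y', which act by 0. *)
Lemma gl_rep_d A : gl_rep (gl_d A) = 0.
Proof.
rewrite /gl_rep /gl_d !mxE !sum2 !mxE /= !(mul0r, mulr0, mul1r, mulr1).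
by rewrite !(add0r, addr0) subrr !scale0r addr0.
Qed.

(** As d of anything acts by 0, compatibility with the defining relation of
    U(gl(P)) is that of a representation for the bracket. *)
Lemma gl_rep_br A B :
  gl_rep A *m gl_rep B = gl_rep B *m gl_rep A + gl_rep (gl_br A B).
Proof.
have YX : Y *m X = X + X *m Y by rewrite -{2}XY addrAC (addkk2 k2) add0r.
have two0 : 2%:R = 0 :> k by exact: (pcharf0 k2).
rewrite /gl_rep !(mulmxDl, mulmxDr) -!scalemxAl -!scalemxAr !scalerA YX.
apply/matrixP=> i j; rewrite !mxE !sum2 !mxE !sum2 !mxE /=.
(* The two sides differ by twice this multiple of Y, which comes from the
   diagonal of [gl_br A B]. *)
rewrite -[LHS](addr0) -[X in _ + X](mul0r ((A 0 1 * B 1 0 - B 0 1 * A 1 0) * Y i j)).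
by rewrite -two0; ring.
Qed.

Lemma uterm_repP s t : ucong s t -> uterm_rep s = uterm_rep t.
Proof.
elim=> {s t} /=.
- by [].
- by move=> s t _ ->.
- by move=> s t u _ -> _ ->.
- by move=> s s' t t' _ -> _ ->.
- by move=> s s' t t' _ -> _ ->.
- by move=> s t u; rewrite addrA.
- by move=> s t; rewrite addrC.
- by move=> s; rewrite raddf0 add0r.
- by move=> s; rewrite mul_scalar_mx scaleN1r addNr raddf0.
- by move=> s t u; rewrite mulmxA.
- by move=> s; rewrite mul1mx.
- by move=> s; rewrite mulmx1.
- by move=> s t u; rewrite mulmxDl.
- by move=> s t u; rewrite mulmxDr.
- by move=> a b; rewrite raddfD.
- by move=> a b; rewrite scalar_mxM.
- by move=> a s; rewrite scalar_mxC.
- by move=> A B; rewrite /gl_rep !mxE opprD addrACA !scalerDl addrACA.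
- by move=> a A; rewrite /gl_rep !mxE mul_scalar_mx scalerDr !scalerA mulrBr.
- by move=> A B; rewrite gl_rep_d mul0mx addr0 gl_rep_br.
Qed.

Definition U_rep (u : UglP k) : 'M[k]_n := uterm_rep (repr u).

Lemma U_repE s : U_rep (\pi_(UglP k) s) = uterm_rep s.
Proof. exact/uterm_repP/ucong_repr. Qed.

Lemma U_repD u v : U_rep (u + v) = U_rep u + U_rep v.
Proof.
by elim/UglP_ind: u => s; elim/UglP_ind: v => t; rewrite -UpiD !U_repE.
Qed.

Lemma U_repM u v : U_rep (u * v) = U_rep u *m U_rep v.
Proof.
by elim/UglP_ind: u => s; elim/UglP_ind: v => t; rewrite -UpiM !U_repE.
Qed.

Lemma U_repZ c u : U_rep (c *: u) = c *: U_rep u.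
Proof.
by rewrite -[c *: u]/(Uconst c * u) U_repM U_repE /= mul_scalar_mx.
Qed.

Lemma U_rep_in A : U_rep (Uin A) = gl_rep A.
Proof. exact: U_repE. Qed.

Lemma U_rep_1e : U_rep (1 - Ue) = 1%:M.
Proof.
rewrite U_repD -scaleN1r U_repZ U_rep_in /gl_rep !mxE subrr !scale0r addr0.
by rewrite scaler0 addr0 U_repE.
Qed.

(** With d = 0 on the underlying object, this is what makes the action a morphism
    in the category. *)
Lemma U_rep_d u : U_rep (Ud u) = 0.
Proof.
elim/UglP_ind: u => s; rewrite UdE // U_repE.
elim: s => [c|A|s IHs t IHt|s IHs t IHt] /=.
- by rewrite raddf0.
- exact: gl_rep_d.
- by rewrite IHs IHt addr0.
- by rewrite IHs IHt mul0mx mulmx0 addr0.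
Qed.

Definition mx_act (u : A0 k2) : 'End(ver4_unit k n) :=
  linfun (mulmx (U_rep (A0val u)) : 'cV[k]_n -> 'cV[k]_n).

Lemma mx_actE u (w : 'cV[k]_n) : mx_act u w = U_rep (A0val u) *m w.
Proof. exact: lfunE. Qed.

Fact mx_act_linear : linear mx_act.
Proof.
move=> c u v; apply/lfunP=> w.
by rewrite add_lfunE scale_lfunE !mx_actE /= U_repD U_repZ mulmxDl -scalemxAl.
Qed.

Fact mx_act1 : mx_act 1 = \1%VF.
Proof. by apply/lfunP=> w; rewrite mx_actE U_rep_1e mul1mx lfunE. Qed.

Fact mx_actM u v : mx_act (u * v) = (mx_act u \o mx_act v)%VF.
Proof.
by apply/lfunP=> w; rewrite comp_lfunE !mx_actE U_repM mulmxA.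
Qed.

Fact mx_act_d u m :
  ver4_d (ver4_unit k n) (mx_act u m)
    = mx_act (A0d u) m + mx_act u (ver4_d (ver4_unit k n) m).
Proof. by rewrite /= !zero_lfunE linear0 mx_actE U_rep_d mul0mx addr0. Qed.

Definition mx_module : A0Mod k2 :=
  @Ver4Mod k (A0 k2) (@A0d k k2) (ver4_unit k n) mx_act
    mx_act_linear mx_act1 mx_actM mx_act_d.

Lemma mx_moduleE A (w : 'cV[k]_n) :
  vact mx_module (A0in k2 A) w = gl_rep A *m w.
Proof. by rewrite mx_actE U_repM U_rep_1e mulmx1 U_rep_in. Qed.

Lemma mx_module_x (w : 'cV[k]_n) : vact mx_module (A0in k2 (gl_x k)) w = X *m w.
Proof. by rewrite mx_moduleE /gl_rep !mxE /= scale1r subrr scale0r addr0. Qed.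

Lemma mx_module_y (w : 'cV[k]_n) : vact mx_module (A0in k2 (gl_y k)) w = Y *m w.
Proof. by rewrite mx_moduleE /gl_rep !mxE /= scale0r subr0 scale1r add0r. Qed.

Lemma mx_module_y' (w : 'cV[k]_n) : vact mx_module (A0in k2 (gl_y' k)) w = 0.
Proof.
by rewrite mx_moduleE /gl_rep !mxE /= subrr !scale0r addr0 mul0mx.
Qed.

Lemma mx_module_form : A0_matrix_form mx_module X Y 0 0.
Proof.
exists \1%VF; split=> [|w].
  split; last by move=> w; rewrite !id_lfunE.
  by exists id => w; rewrite lfunE.
rewrite !id_lfunE; split.
- exact: mx_module_x.
- exact: mx_module_y.
- by rewrite mul0mx; exact: mx_module_y'.
- by rewrite A0in_e vact0 mul0mx.
Qed.

End MatrixModule.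

(** * The modules L(a,b) *)

Section Models.
Variables (k : fieldType) (k2 : 2%N \in [pchar k]).
Local Notation x := (A0in k2 (gl_x k)).
Local Notation y := (A0in k2 (gl_y k)).
Implicit Types M : A0Mod k2.

Fact mx1_rel (b : k) : (0 : 'M_1) *m b%:M + b%:M *m 0 = 0.
Proof. by rewrite mul0mx mulmx0 addr0. Qed.

Local Notation e1 := (delta_mx 0 0 : 'cV[k]_2).
Local Notation e2 := (delta_mx 1 0 : 'cV[k]_2).

Lemma cV2_basis (w : 'cV[k]_2) : w = w 0 0 *: e1 + w 1 0 *: e2.
Proof.
apply/matrixP=> i j; rewrite (ord1 j) !mxE; case: i => [[|[|[]]]] //= l.
  by rewrite mulr1 mulr0 addr0; congr (w _ _); apply: val_inj.
by rewrite mulr1 mulr0 add0r; congr (w _ _); apply: val_inj.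
Qed.

Lemma mx2_mul (a b c d : k) (w : 'cV[k]_2) :
  mx2 a b c d *m w
    = (a * w 0 0 + b * w 1 0) *: e1 + (c * w 0 0 + d * w 1 0) *: e2.
Proof.
rewrite [LHS]cV2_basis !mxE !big_ord_recl !big_ord0 !addr0 !mxE /=.
by rewrite (_ : lift 0 0 = 1) //; apply: val_inj.
Qed.

Fact mx2_rel (a b : k) :
  mx2 0 1 a 0 *m mx2 b 0 0 (b + 1) + mx2 b 0 0 (b + 1) *m mx2 0 1 a 0
    = mx2 0 1 a 0.
Proof.
have bb : b + b = 0 by exact: (addkk2 k2 (b : k^o)).
apply/matrixP=> i j; rewrite !mxE !big_ord_recl !big_ord0 !mxE /=.
case: i => [[|[|[]]]] //= _; case: j => [[|[|[]]]] //= _;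
  rewrite !(mul0r, mulr0, mul1r, mulr1, add0r, addr0) //.
  by rewrite addrAC bb add0r.
by rewrite mulrDl mul1r addrA (mulrC b) -mulrDr bb mulr0 add0r.
Qed.

Definition L_module (a b : k) : A0Mod k2 :=
  if a == 0 then mx_module k2 (mx1_rel b) else mx_module k2 (mx2_rel a b).

Lemma L_at0 b : L_module 0 b = mx_module k2 (mx1_rel b).
Proof. by rewrite /L_module eqxx. Qed.

Lemma L_at_neq0 a b : a != 0 -> L_module a b = mx_module k2 (mx2_rel a b).
Proof. by rewrite /L_module => /negPf->. Qed.

Lemma L_at0_simple b : vsimple (mx_module k2 (mx1_rel b)).
Proof.
have d1 : \dim (fullv : {vspace 'cV[k]_1}) = 1%N by rewrite dimvf.
split=> [|W _]; first by rewrite -dimv_eq0 [\dim _]d1.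
have [W0|W0] := eqVneq W 0%VS; [by left | right].
by apply/eqP; rewrite eqEdim subvf /= [\dim _]d1 lt0n dimv_eq0.
Qed.

(** For w in a submodule, yw + bw is a multiple of e2, and x exchanges the lines
    of e1 and e2; so a nonzero w yields both basis vectors. *)
Lemma L_at_neq0_simple a b : a != 0 -> vsimple (mx_module k2 (mx2_rel a b)).
Proof.
move=> a0; have d2 : \dim (fullv : {vspace 'cV[k]_2}) = 2%N by rewrite dimvf.
split=> [|W [_ sW]]; first by rewrite -dimv_eq0 [\dim _]d2.
have sWx (w : 'cV[k]_2) : w \in W -> w 1 0 *: e1 + (a * w 0 0) *: e2 \in W.
  move=> Ww; have := subvP (sW x) _ (memv_img _ Ww).
  by rewrite mx_module_x mx2_mul !mul0r mul1r addr0 add0r.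
have sWy (w : 'cV[k]_2) : w \in W -> w 1 0 *: e2 \in W.
  move=> Ww; have := subvP (sW y) _ (memv_img _ Ww).
  rewrite mx_module_y mx2_mul !mul0r addr0 add0r mulrDl mul1r scalerDl addrA.
  rewrite -!scalerA -scalerDr -cV2_basis => /memvB/(_ (memvZ b Ww)).
  by rewrite addrAC subrr add0r.
have [W0|W0] := eqVneq W 0%VS; [by left | right].
suff [We1 We2] : e1 \in W /\ e2 \in W.
  apply/eqP; rewrite eqEsubv subvf; apply/subvP=> w _.
  by rewrite [w : 'cV_2]cV2_basis rpredD ?rpredZ.
have {W0} := W0; rewrite -vpick0; have := memv_pick W; move: (vpick W) => w Ww w0.
have divW (c : k) (u : 'cV[k]_2) : c != 0 -> c *: u \in W -> u \in W.
  by move=> c0 /(rpredZ c^-1); rewrite scalerA mulVf // scale1r.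
have [w10|w10] := eqVneq ((w : 'cV_2) 1 0) 0; last first.
  have We2 := divW _ _ w10 (sWy _ Ww); split=> //.
  by have := sWx _ We2; rewrite !mxE /= scale1r mulr0 scale0r addr0.
have w00 : (w : 'cV_2) 0 0 != 0.
  apply: contraNneq w0 => w00.
  by rewrite [w : 'cV_2]cV2_basis w00 w10 !scale0r addr0.
have We1 : e1 \in W.
  apply: (divW _ _ w00).
  by move: Ww; rewrite {1}[w : 'cV_2]cV2_basis w10 scale0r addr0.
split=> //; apply: (divW _ _ a0).
by have := sWx _ We1; rewrite !mxE /= scale0r mulr1 add0r.
Qed.

Lemma L_module_simple a b : vsimple (L_module a b).
Proof.
have [->|a0] := eqVneq a 0; first by rewrite L_at0; exact: L_at0_simple.
by rewrite L_at_neq0 //; exact: L_at_neq0_simple.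
Qed.

Lemma linfun_exists (V W : vectType k) (h : V -> W) :
  linear h -> exists f : 'Hom(V, W), f =1 h.
Proof.
move=> hl; pose hL : {linear V -> W} :=
  HB.pack h (GRing.isLinear.Build _ _ _ _ h hl).
by exists (linfun hL) => v; rewrite lfunE.
Qed.

(** The isomorphism sends the first basis vector to v and, when a != 0, the second
    to xv / a; the matrix of x in L(a,b) is exactly multiplication by x on these
    two vectors.  Schur's lemma then replaces the computation of the dimension of
    M. *)
Lemma simple_iso_L M a b (v : M) : vsimple M -> v != 0 ->
  (forall m, vact M x (vact M x m) = a *: m) ->
  vact M y v = b *: v -> vmod_iso (L_module a b) M.
Proof.
move=> sM v0 xx yv; have [a0|a0] := eqVneq a 0.
  rewrite a0 L_at0.
  have x0 m : vact M x m = 0.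
    by apply: (simple_x0 sM) => m'; rewrite xx a0 scale0r.
  have [|f fE] := @linfun_exists 'cV[k]_1 M (fun w => w 0 0 *: v).
    by move=> c u w; rewrite !mxE scalerDl scalerA.
  have fv : f 1%:M = v by rewrite fE mxE scale1r.
  apply: (@schur _ _ (mx_module k2 (mx1_rel b)) M f 1%:M) => //.
  - exact: L_at0_simple.
  - by move=> m; rewrite [RHS]simple_d0 // zero_lfunE linear0.
  - apply: vact_comm_gen => m.
    + by rewrite mx_module_x mul0mx linear0 x0.
    + by rewrite mx_module_y mul_scalar_mx linearZ /= (simple_yb sM x0 v0 yv).
    + by rewrite mx_module_y' linear0 simple_y'0.
  - by rewrite fv.
rewrite L_at_neq0 //.
have [|f fE] := @linfun_exists 'cV[k]_2 M
    (fun w => w 0 0 *: v + (w 1 0 / a) *: vact M x v).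
  by move=> c u w; rewrite !mxE mulrDl !scalerDl -mulrA -!scalerA scalerDr addrACA.
have f1 : f e1 = v by rewrite fE !mxE /= mul0r scale0r addr0 scale1r.
have f2 : f e2 = a^-1 *: vact M x v.
  by rewrite fE !mxE /= scale0r add0r mul1r.
have fD c d : f (c *: e1 + d *: e2) = c *: v + (d / a) *: vact M x v.
  by rewrite linearD !linearZ /= f1 f2 scalerA.
apply: (@schur _ _ (mx_module k2 (mx2_rel a b)) M f e1) => //.
- exact: L_at_neq0_simple.
- by move=> m; rewrite [RHS]simple_d0 // zero_lfunE linear0.
- apply: vact_comm_gen => m.
  + rewrite mx_module_x mx2_mul !mul0r mul1r addr0 add0r fD fE linearD !linearZ /=.
    by rewrite xx scalerA divfK // mulrAC divff // mul1r addrC.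
  + have yx : vact M y (vact M x v) = (b + 1) *: vact M x v.
      have := simple_xy sM v; rewrite yv linearZ /= scalerDl scale1r => ->.
      by rewrite -addrA (addkk2 k2) addr0.
    rewrite mx_module_y mx2_mul !mul0r addr0 add0r fD fE linearD !linearZ /=.
    by rewrite yv yx !scalerA -mulrA (mulrC b) (mulrC (b + 1)).
  + by rewrite mx_module_y' linear0 simple_y'0.
- by rewrite f1.
Qed.

Lemma L_x_square a b (m : L_module a b) : vact _ x (vact _ x m) = a *: m.
Proof.
have [a0|a0] := eqVneq a 0.
  subst a; rewrite scale0r; move: m; rewrite L_at0 => m.
  by rewrite mx_module_x mul0mx.
move: m; rewrite L_at_neq0 // => m; rewrite !mx_module_x !mx2_mul !mxE /=.
by rewrite !(mul0r, mul1r, mulr0, mulr1, add0r, addr0) -!scalerA -scalerDr -cV2_basis.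
Qed.

Lemma L_eigenvector a b : exists2 v : L_module a b, v != 0 & vact _ y v = b *: v.
Proof.
have [->|a0] := eqVneq a 0.
  rewrite L_at0; exists (1%:M : 'cV_1); first exact: oner_neq0.
  by rewrite mx_module_y mulmx1 scalemx1.
rewrite L_at_neq0 //; exists e1.
  by apply/eqP=> /matrixP/(_ 0 0)/eqP; rewrite !mxE /= oner_eq0.
by rewrite mx_module_y mx2_mul !mxE /= !(mul0r, mulr0, mulr1, addr0, scale0r).
Qed.

Lemma L_eigenvector_add1 a b : a != 0 ->
  exists2 v : L_module a b, v != 0 & vact _ y v = (b + 1) *: v.
Proof.
move=> a0; rewrite L_at_neq0 //; exists e2.
  by apply/eqP=> /matrixP/(_ 1 0)/eqP; rewrite !mxE /= oner_eq0.
by rewrite mx_module_y mx2_mul !mxE /= !(mul0r, mulr0, mulr1, add0r, scale0r).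
Qed.

Lemma L_eigenvalue a b c (v : L_module a b) : v != 0 -> vact _ y v = c *: v ->
  c = b \/ a != 0 /\ c = b + 1.
Proof.
have [a0|a0] := eqVneq a 0.
  subst a; move: v; rewrite L_at0 => v v0 /eqP.
  rewrite mx_module_y mul_scalar_mx -subr_eq0 -scalerBl scaler_eq0 (negPf v0).
  by rewrite orbF subr_eq0 => /eqP->; left.
move: v; rewrite L_at_neq0 // => v v0; rewrite mx_module_y mx2_mul => /matrixP yv.
have := yv 0 0; have := yv 1 0; rewrite !mxE /=.
rewrite !(mul0r, mul1r, mulr0, mulr1, add0r, addr0) => /eqP.
rewrite -subr_eq0 -mulrBl mulf_eq0 subr_eq0 => y1 /eqP.
rewrite -subr_eq0 -mulrBl mulf_eq0 subr_eq0 => y0; move: y1 y0.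
case/orP=> [/eqP->|v1]; first by right.
case/orP=> [/eqP->|v2]; first by left.
by move: v0; rewrite [v : 'cV_2]cV2_basis (eqP v1) (eqP v2) !scale0r addr0 eqxx.
Qed.

Lemma vmod_iso_sym M N : vmod_iso M N -> vmod_iso N M.
Proof.
case=> f [[[g fK gK] fd] fu].
have kf : lker f == 0%VS by apply/lker0P; exact: can_inj fK.
have gE w : (f^-1)%VF w = g w by rewrite -{1}[w]gK lker0_lfunK.
exists (f^-1)%VF; split; first split.
- by exists f => w; rewrite gE ?fK ?gK.
- by move=> w; rewrite !gE -{1}[w]gK -fd fK.
- by move=> u w; rewrite !gE -{1}[w]gK -fu fK.
Qed.

(** An isomorphism transports the scalar by which x^2 acts and the eigenvalue b of
    y. *)
Lemma L_iso_inv a b a' b' : vmod_iso (L_module a b) (L_module a' b') ->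
  a = a' /\ (b = b' \/ a != 0 /\ b' = b + 1).
Proof.
case=> f [[[g fK _] _] fu]; have [v v0 yv] := L_eigenvector a b.
have fv0 : f v != 0.
  by apply: contraNneq v0 => fv0; rewrite -[v]fK fv0 -(linear0 f) fK.
have aa : a = a'.
  have := congr1 f (L_x_square v); rewrite !fu L_x_square linearZ /= => /eqP.
  by rewrite -subr_eq0 -scalerBl scaler_eq0 (negPf fv0) orbF subr_eq0 => /eqP.
split=> //; have := congr1 f yv; rewrite fu linearZ /=.
move/(L_eigenvalue fv0) => [->|[a0 ->]]; [by left | right].
by rewrite aa; split=> //; rewrite -addrA (addkk2 k2 (1 : k^o)) addr0.
Qed.

End Models.

Theorem proposition7p9 (k : closedFieldType) (k2 : 2%N \in [pchar k]) :
  exists L : k -> k -> A0Mod k2,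
    [/\ (forall b : k,
           A0_matrix_form (L 0 b) (n := 1) 0 b%:M 0 0)
        /\ (forall a b : k, a != 0 ->
           A0_matrix_form (L a b)
             (mx2 0 1 a 0) (mx2 b 0 0 (b + 1)) 0 0),
        (forall a b : k, vsimple (L a b)),
        (forall M : A0Mod k2, vsimple M ->
           exists a b : k, vmod_iso M (L a b)),
        (* (a,b) is determined by the module up to b |-> b + 1 *)
        (forall a b a' b' : k, vmod_iso (L a b) (L a' b') ->
           a = a' /\ (b = b' \/ a != 0 /\ b' = b + 1))
      & forall b : k, vmod_iso (L 1 b) (L 1 (b + 1))].
Proof.
exists (L_module k2); split.
- split=> [b|a b a0]; first by rewrite L_at0; exact: mx_module_form.
  by rewrite L_at_neq0 //; exact: mx_module_form.
- exact: L_module_simple.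
- move=> M sM; have [a [b [v [v0 xx yv]]]] := simple_eigen sM.
  exists a, b; apply: vmod_iso_sym; exact: (simple_iso_L sM v0 xx yv).
- exact: L_iso_inv.
- move=> b; have [v v0 yv] := L_eigenvector_add1 k2 b (oner_neq0 k).
  apply: vmod_iso_sym.
  exact: (simple_iso_L (L_module_simple k2 1 b) v0 (@L_x_square _ k2 1 b) yv).
Qed.
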